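(* For every integer $n\ge 0$, the Hankel determinant $H_n(x)=\det[a_{i+j}(x)]_{0\le i,j\le n}$, where $a_k(x)=\sum_{m=0}^k\binom{2k+2-m}{k-m}x^m$, satisfies $$H_n(x)=(-1)^n\sum_{k=0}^n\left[(2n+3)\binom{n+k}{2k+1}+(2k+1)\binom{n+k+1}{2k+1}\right](x-2)^k$$ and $$H_n(x)=\sum_{k=0}^n(-1)^k\left[(n+k+1)\binom{n+k}{2k}+(2n+4k+1)\binom{n+k}{2k+1}+8(k+1)\binom{n+k+1}{2k+3}\right](x+2)^k.$$
   Context: $x$ is an indeterminate. The matrix $[a_{i+j}(x)]_{0\le i,j\le n}$ is the $(n+1)\times(n+1)$ matrix with $(i,j)$ entry $a_{i+j}(x)$. Binomial coefficients $\binom{r}{s}$ with integers $0\le r<s$ are $0$. *)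

(* Defs.v *)
From mathcomp Require Import all_boot all_order all_algebra.

Set Implicit Arguments.
Unset Strict Implicit.
Unset Printing Implicit Defensive.

Import GRing.Theory.
Local Open Scope ring_scope.

(* The natural subtractions never truncate, since m <= k. *)
Definition hankel_entry (k : nat) : {poly int} :=
  \sum_(0 <= m < k.+1) 'C(2 * k + 2 - m, k - m)%N%:R * 'X^m.

Definition hankel_det (n : nat) : {poly int} :=
  \det (\matrix_(i < n.+1, j < n.+1) hankel_entry (i + j)%N).

(* Main.v *)
Require Import Defs.
From mathcomp Require Import all_boot all_order all_algebra.
From mathcomp Require Import zify ring.

(** With z = (1 + u)^2 / u, the entry a_k is the constant term of z^(k+1) f(u),
    where f(u) = u (1 + u) / (1 - (x-1) u) = \sum_k f_k u^k.  Expanding z^i in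
    the Chebyshev polynomials of the third kind turns the Hankel matrix, by a
    unitriangular congruence, into (f_(l+m+1) + f_|l-m|), and a second such
    congruence by 1 - (x-1) shift turns this one into a pentadiagonal matrix
    which away from its corner is Toeplitz with symbol (s+2)(s-x), s = u + 1/u.
    Its second superdiagonal consists of ones, so its leading minors are
    Casoratians of two kernel sequences, which come from the roots s = -2 and
    s = x of the symbol.  This gives, for the Chebyshev polynomials U_n,
      (x+2) H_n = (-1)^n (((2n+1)x+2) U_n + ((2n+3)x+2) U_(n-1)).
    Both formulas follow by expanding U_n and its derivative in powers of
    x - 2, respectively -(x + 2). *)

Import GRing.Theory.
Local Open Scope ring_scope.

(** * Determinants: unitriangular congruence and Casoratians *)

(** The sums stop at the diagonal of [P], so the left matrix is Q M Q^T with Q lower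
    unitriangular. *)
Lemma det_unitriangular_congruence (R : comNzRingType) (n : nat)
    (P M : nat -> nat -> R) :
  (forall i, P i i = 1) ->
  \det (\matrix_(i < n, j < n)
     \sum_(l < i.+1) \sum_(m < j.+1) P i l * P j m * M l m) =
  \det (\matrix_(i < n, j < n) M i j).
Proof.
move=> P1; pose Q := \matrix_(i < n, l < n) (if (l < i.+1)%N then P i l else 0).
have detQ : \det Q = 1.
  rewrite det_trig; first by rewrite big1 // => i _; rewrite mxE ltnSn P1.
  by apply/is_trig_mxP => i j lt_ij; rewrite mxE ltnS leqNgt lt_ij.
have sumQ (i : 'I_n) (F : nat -> R) :
    \sum_(l < i.+1) P i l * F l = \sum_(l < n) Q i l * F l.
  rewrite (big_ord_widen n (fun l => P i l * F l)) // big_mkcond.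
  apply: eq_bigr => l _.
  by rewrite mxE; case: ifP => //; rewrite mul0r.
transitivity (\det (Q *m (\matrix_(i < n, j < n) M i j) *m Q^T)); last first.
  by rewrite !det_mulmx det_tr detQ mul1r mulr1.
congr (\det _); apply/matrixP => i j; rewrite mxE -mulmxA mxE.
transitivity (\sum_(l < i.+1) P i l * \sum_(m < j.+1) P j m * M l m).
  by apply: eq_bigr => l _; rewrite mulr_sumr; apply: eq_bigr => m _; rewrite mulrA.
rewrite (sumQ i (fun l => \sum_(m < j.+1) P j m * M l m)).
apply: eq_bigr => l _; congr (_ * _).
rewrite (sumQ j (fun m => M l m)) !mxE.
by apply: eq_bigr => m _; rewrite !mxE mulrC.
Qed.

Lemma det_mx22 (R : comNzRingType) (A : 'M[R]_2) :
  \det A = A 0 0 * A 1 1 - A 0 1 * A 1 0.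
Proof.
rewrite (expand_det_row _ 0) big_ord_recl big_ord1 /cofactor !det_mx11 !mxE /=.
rewrite mul1r mulN1r mulrN; congr (_ * A _ _ - A _ _ * A _ _); exact: val_inj.
Qed.

(** The columns are e_2, ..., e_(n+1), a, b. Expanding along e_2 strikes row 2 with sign +1, so rows
    0 and 1 survive down to the 2 by 2 case. *)
Lemma det_shift_two_columns (R : comNzRingType) (n : nat) (a b : nat -> R) :
  \det (\matrix_(i < n.+2, j < n.+2)
     (if (j < n)%N then (i == j.+2 :> nat)%:R
      else if j == n :> nat then a i else b i)) = a 0%N * b 1%N - a 1%N * b 0%N.
Proof.
elim: n a b => [|n IHn] a b; first by rewrite det_mx22 !mxE /=; ring.
pose skip (c : nat -> R) k := c (bump 2 k).
rewrite -(IHn (skip a) (skip b)).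
rewrite (expand_det_col _ ord0) (bigD1 (inord 2)) //= big1 ?addr0; last first.
  move=> i ne_i2; rewrite mxE /=; case: eqP => [i2|]; last by rewrite mul0r.
  by case/eqP: ne_i2; apply: val_inj; rewrite /= inordK.
rewrite mxE /= inordK // eqxx mul1r /cofactor inordK // addn0 sqrrN expr1n mul1r.
congr (\det _); apply/matrixP => i j; rewrite !mxE /= inordK // /bump leq0n add1n.
rewrite ltnS eqSS; congr (if _ then _ else _); congr (_%:R); rewrite /bump.
by congr nat_of_bool; lia.
Qed.

(* The n rows of K on n + 2 columns, completed by e_n and e_(n+1), times the
   matrix with columns e_2, ..., e_(n+1), a, b is block triangular with blocks
   a unitriangular matrix and the Casorati matrix of a and b at n. *)
Lemma det_two_superdiagonals (R : comNzRingType) (n : nat)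
    (K : nat -> nat -> R) (a b : nat -> R) :
  (forall i, K i i.+2 = 1) -> (forall i j, (i.+2 < j)%N -> K i j = 0) ->
  (forall i, \sum_(j < i.+3) K i j * a j = 0) ->
  (forall i, \sum_(j < i.+3) K i j * b j = 0) ->
  \det (\matrix_(i < n, j < n) K i j) * (a 0%N * b 1%N - a 1%N * b 0%N) =
  a n * b n.+1 - a n.+1 * b n.
Proof.
move=> K1 K0 Ka Kb.
pose Kx : 'M_(n + 2) := block_mx (\matrix_(i, j) K i j)
  (\matrix_(i, j) K i (n + j)%N) 0 1%:M.
pose Z : 'M_(n + 2) := \matrix_(i < n + 2, j < n + 2)
  (if (j < n)%N then (i == j.+2 :> nat)%:R
   else if j == n :> nat then a i else b i).
have detZ : \det Z = a 0%N * b 1%N - a 1%N * b 0%N.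
  by rewrite -(det_shift_two_columns R n) /Z addn2.
have detKx : \det Kx = \det (\matrix_(i < n, j < n) K i j).
  by rewrite det_ublock det1 mulr1.
rewrite -detZ -detKx -det_mulmx.
have KxE (i : 'I_n) (j : 'I_(n + 2)) : Kx (lshift 2 i) j = K i j.
  by case: (split_ordP j) => k ->; rewrite /Kx ?block_mxEul ?block_mxEur mxE.
(* Row i of [K] ends at column i + 2 <= n + 1, so n + 2 columns hold the whole kernel relation. *)
have KxZ (i : 'I_n) (c : nat -> R) :
    \sum_(k < n + 2) Kx (lshift 2 i) k * c k = \sum_(k < i.+3) K i k * c k.
  rewrite (big_ord_widen (n + 2) (fun k => K i k * c k)); last first.
    by have := ltn_ord i; lia.
  rewrite [RHS]big_mkcond; apply: eq_bigr => k _; rewrite KxE.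
  by case: ltnP => // lt_ik; rewrite K0 ?mul0r.
pose L : 'M[R]_n := \matrix_(i, j) K i j.+2.
pose C : 'M[R]_2 := \matrix_(i, j) (if j == 0 then a (n + i)%N else b (n + i)%N).
have KxZE : Kx *m Z = block_mx L 0
    (\matrix_(i, j) ((n + i)%N == j.+2 :> nat)%:R) C.
  apply/matrixP => i j; case: (split_ordP i) => p ->; rewrite mxE.
    case: (split_ordP j) => q ->.
      rewrite block_mxEul mxE.
      have q2 : (q.+2 < n + 2)%N by have := ltn_ord q; lia.
      rewrite (bigD1 (Ordinal q2)) //= big1 ?addr0.
        by rewrite KxE mxE /= ltn_ord eqxx mulr1.
      move=> k /negP ne_k; rewrite [Z _ _]mxE /= ltn_ord.
      by case: eqP => [eq_k|]; [case: ne_k; apply/eqP/val_inj | rewrite mulr0].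
    rewrite block_mxEur mxE.
    rewrite (eq_bigr (fun k : 'I_(n + 2) => Kx (lshift 2 p) k *
      (if q == 0 then a k else b k))); last first.
      move=> k _; rewrite [Z _ _]mxE /= ltnNge leq_addr /= -[X in _ == X]addn0 eqn_add2l.
      by [].
    case: (q == 0); first by rewrite (KxZ p a).
    by rewrite (KxZ p b).
  rewrite (bigD1 (rshift n p)) //= big1 ?addr0.
    rewrite /Kx block_mxEdr mxE eqxx mul1r [Z _ _]mxE.
    case: (split_ordP j) => q ->; first by rewrite block_mxEdl [RHS]mxE.
    rewrite block_mxEdr [RHS]mxE /= -[X in _ == X]addn0 eqn_add2l.
    by [].
  move=> k; case: (split_ordP k) => k' ->; rewrite /Kx.
    by rewrite block_mxEdl mxE mul0r.
  rewrite block_mxEdr mxE eq_rshift eq_sym => /negPf ->.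
  by rewrite mul0r.
rewrite KxZE det_lblock det_trig; last first.
  by apply/is_trig_mxP => i j lt_ij; rewrite mxE K0.
rewrite big1 ?mul1r; last by move=> i _; rewrite mxE K1.
by rewrite det_mx22 !mxE /= !addn0 addn1; ring.
Qed.

(** * Binomial sums *)

Lemma sum_binomS (R : comNzRingType) (n : nat) (F : nat -> R) :
  \sum_(r < n.+2) 'C(n.+1, r)%:R * F r =
  \sum_(r < n.+1) 'C(n, r)%:R * (F r + F r.+1).
Proof.
rewrite big_ord_recl /= bin0.
under eq_bigr => r _ do rewrite binS natrD mulrDl.
rewrite big_split /= big_ord_recr /= bin_small // mul0r addr0 addrA.
under [RHS]eq_bigr => r _ do rewrite mulrDr.
rewrite [RHS]big_split /=; congr (_ + _).
by rewrite [RHS]big_ord_recl /= bin0.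
Qed.

(** Vandermonde for the shift E: (1 + E)^(m+n) = (1 + E)^m (1 + E)^n, applied to [F] at 0. *)
Lemma sum_binomD (R : comNzRingType) (m n : nat) (F : nat -> R) :
  \sum_(r < (m + n).+1) 'C(m + n, r)%:R * F r =
  \sum_(p < m.+1) 'C(m, p)%:R * \sum_(q < n.+1) 'C(n, q)%:R * F (p + q)%N.
Proof.
elim: m F => [|m IHm] F; first by rewrite big_ord1 bin0 mul1r.
rewrite addSn sum_binomS (IHm (fun r => F r + F r.+1)).
rewrite (sum_binomS _ m (fun p => \sum_(q < n.+1) 'C(n, q)%:R * F (p + q)%N)).
apply: eq_bigr => p _; congr (_ * _); rewrite -big_split.
by apply: eq_bigr => q _; rewrite mulrDr addSn.
Qed.

(** An odd row is symmetric about its middle. For F p = u^p, division by u^i (1 + u) gives z^i in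
    Chebyshev polynomials of the third kind. *)
Lemma sum_binom_odd (R : comNzRingType) (i : nat) (F : nat -> R) :
  \sum_(p < (2 * i + 1).+1) 'C(2 * i + 1, p)%:R * F p =
  \sum_(l < i.+1) 'C(2 * i + 1, i - l)%:R * (F (i - l)%N + F (i.+1 + l)%N).
Proof.
rewrite (_ : (2 * i + 1).+1 = i.+1 + i.+1)%N; last by lia.
rewrite big_split_ord /= (reindex_inj rev_ord_inj) -big_split /=.
apply: eq_bigr => l _; rewrite subSS mulrDr; congr (_ + _ * _).
have lt_li := ltn_ord l.
congr (_%:R).
rewrite -[RHS]bin_sub; last by lia.
by congr 'C(_, _); lia.
Qed.

(** Both sides are the coefficient of u^k in (1 + u)^(n+1) / (1 - (x-1) u); on the right this is (1
    + u)^n / (1 - x u / (1 + u)). *)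
Lemma sum_binom_recenter (R : comNzRingType) (x : R) (n k : nat) :
  (k <= n)%N ->
  \sum_(r < k.+1) 'C(n.+1, r)%:R * (x - 1) ^+ (k - r) =
  \sum_(m < k.+1) 'C(n - m, k - m)%:R * x ^+ m.
Proof.
pose W n k := \sum_(r < k.+1) 'C(n, r)%:R * (x - 1) ^+ (k - r).
have WS m j : W m j.+1 = (x - 1) * W m j + 'C(m, j.+1)%:R.
  rewrite /W big_ord_recr /= subnn mulr1 mulr_sumr; congr (_ + _).
  apply: eq_bigr => r _; rewrite subSn; last by rewrite -ltnS ltn_ord.
  by rewrite exprS mulrCA.
have WSS m j : W m.+1 j.+1 = W m j.+1 + W m j.
  rewrite /W big_ord_recl [in RHS]big_ord_recl /= !bin0 -addrA; congr (_ + _).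
  rewrite -big_split; apply: eq_bigr => r _.
  by rewrite /= /bump /= add1n binS natrD mulrDl subSS.
rewrite -/(W n.+1 k); elim: k n => [|k IHk] [|n] // le_kn.
- by rewrite /W !big_ord1 !bin0.
- by rewrite /W !big_ord1 !bin0.
(* Together: [W n.+2 k.+1 = x * W n.+1 k + 'C(n.+1, k.+1)]. *)
rewrite WSS WS IHk // [RHS]big_ord_recl /= !subn0 expr0 mulr1.
rewrite [X in _ = _ + X](_ : _ =
  x * \sum_(m < k.+1) 'C(n - m, k - m)%:R * x ^+ m); first by ring.
rewrite mulr_sumr; apply: eq_bigr => m _.
by rewrite /bump add1n !subSS exprS mulrCA.
Qed.

(** * Chebyshev polynomials in powers of t = x - 2 *)

(* cheb x n is U_(n-1)(x / 2) for the usual Chebyshev polynomials U. *)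
Fixpoint cheb (R : comNzRingType) (x : R) (n : nat) : R :=
  match n with
  | 0 => 0
  | m.+1 => match m with 0 => 1 | l.+1 => x * cheb R x m - cheb R x l end
  end.

Lemma chebSS (R : comNzRingType) (x : R) n :
  cheb R x n.+2 = x * cheb R x n.+1 - cheb R x n.
Proof. by []. Qed.

Lemma chebN (R : comNzRingType) (x : R) n :
  cheb R (- x) n = (-1) ^+ n.+1 * cheb R x n.
Proof.
suff: cheb R (- x) n = (-1) ^+ n.+1 * cheb R x n /\
      cheb R (- x) n.+1 = (-1) ^+ n.+2 * cheb R x n.+1 by case.
elim: n => [|n [IH1 IH2]]; first by split; rewrite /= ?mulr0 // sqrrN expr1n mulr1.
by split=> //; rewrite !chebSS IH1 IH2 !exprS; ring.
Qed.

(** Pascal's rule couples the two sums. Terms with k > n vanish, so a bound [N] beyond n can stay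
    fixed during the induction. *)
Lemma sum_binom_cheb (R : comNzRingType) (t : R) (N n : nat) :
  (n < N)%N ->
  \sum_(k < N) 'C(n + k, 2 * k + 1)%:R * t ^+ k = cheb R (t + 2) n /\
  \sum_(k < N) 'C(n + k, 2 * k)%:R * t ^+ k
    = cheb R (t + 2) n.+1 - cheb R (t + 2) n.
Proof.
elim: n => [|n IHn] lt_nN.
  split.
    by rewrite big1 // => k _; rewrite bin_small ?mul0r //; lia.
  case: N lt_nN => // N _; rewrite big_ord_recl big1 ?addr0 //=.
    by rewrite subr0 mulr1.
  by move=> k _; rewrite bin_small ?mul0r // /bump /=; lia.
have [IHo IHe] := IHn (ltnW lt_nN).
have So : \sum_(k < N) 'C(n.+1 + k, 2 * k + 1)%:R * t ^+ k = cheb R (t + 2) n.+1.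
  under eq_bigr => k _ do rewrite addSn addn1 binS natrD mulrDl -addn1.
  by rewrite big_split /= IHo IHe addrC subrK.
split=> //.
have -> : \sum_(k < N) 'C(n.+1 + k, 2 * k)%:R * t ^+ k =
    \sum_(k < N) 'C(n + k, 2 * k)%:R * t ^+ k +
    t * \sum_(k < N) 'C(n.+1 + k, 2 * k + 1)%:R * t ^+ k.
  case: N lt_nN {IHn IHo IHe So} => // N lt_nN.
  rewrite big_ord_recl [X in _ = X + _]big_ord_recl [X in _ = _ + _ * X]big_ord_recr /=.
  rewrite [X in _ * (_ + X)](_ : _ = 0) ?addr0; last first.
    by rewrite bin_small ?mul0r //; lia.
  rewrite !bin0 -addrA; congr (_ + _); rewrite mulr_sumr -big_split.
  apply: eq_bigr => k _; rewrite /= /bump /= add1n.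
  rewrite (_ : 2 * k.+1 = (2 * k + 1).+1)%N ?addSn ?binS; last by lia.
  by rewrite addnS natrD exprS; ring.
by rewrite So IHe chebSS; ring.
Qed.

(* The first sum is t U' for U = cheb (t + 2) n as a function of t: this is the
   identity expressing (x^2 - 4) U' through U and its successor. *)
Lemma wsum_binom_cheb (R : comNzRingType) (t : R) (N n : nat) :
  (n < N)%N ->
  (t + 4) * (\sum_(k < N) k%:R * 'C(n + k, 2 * k + 1)%:R * t ^+ k) =
    2 * n%:R * cheb R (t + 2) n.+1 - n.+1%:R * (t + 2) * cheb R (t + 2) n /\
  (t + 4) * (\sum_(k < N) k%:R * 'C(n + k, 2 * k)%:R * t ^+ k) =
    2 * n.+1%:R * cheb R (t + 2) n.+2 - n.+2%:R * (t + 2) * cheb R (t + 2) n.+1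
    - (2 * n%:R * cheb R (t + 2) n.+1 - n.+1%:R * (t + 2) * cheb R (t + 2) n).
Proof.
elim: n => [|n IHn] lt_nN.
  split.
    rewrite big1; first by rewrite /=; ring.
    by move=> k _; rewrite bin_small ?mulr0 ?mul0r //; lia.
  rewrite big1 /=; first by ring.
  case=> -[|k] lt_kN _; first by rewrite !mul0r.
  by rewrite bin_small ?mulr0 ?mul0r //=; lia.
have [IHo IHe] := IHn (ltnW lt_nN).
have So : \sum_(k < N) k%:R * 'C(n.+1 + k, 2 * k + 1)%:R * t ^+ k =
    \sum_(k < N) k%:R * 'C(n + k, 2 * k + 1)%:R * t ^+ k +
    \sum_(k < N) k%:R * 'C(n + k, 2 * k)%:R * t ^+ k.
  rewrite -big_split; apply: eq_bigr => k _ /=.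
  by rewrite addSn addn1 binS natrD; ring.
have [Su _] := sum_binom_cheb R t N n.+1 lt_nN.
(* Pascal's rule and the shift of k to k + 1; the weight k + 1 leaves an extra unweighted sum. *)
have Se : \sum_(k < N) k%:R * 'C(n.+1 + k, 2 * k)%:R * t ^+ k =
    \sum_(k < N) k%:R * 'C(n + k, 2 * k)%:R * t ^+ k +
    t * (\sum_(k < N) k%:R * 'C(n.+1 + k, 2 * k + 1)%:R * t ^+ k
         + \sum_(k < N) 'C(n.+1 + k, 2 * k + 1)%:R * t ^+ k).
  case: N lt_nN {IHn IHo IHe So Su} => // N lt_nN; rewrite -big_split.
  rewrite big_ord_recl [X in _ = X + _]big_ord_recl [X in _ = _ + _ * X]big_ord_recr /=.
  rewrite !mul0r !add0r [X in _ * (_ + X)](_ : _ = 0) ?addr0; last first.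
    by rewrite bin_small ?mulr0 ?mul0r ?addr0 //; lia.
  rewrite mulr_sumr -big_split.
  apply: eq_bigr => k _; rewrite /= /bump /= add1n.
  rewrite (_ : 2 * k.+1 = (2 * k + 1).+1)%N ?addSn ?binS; last by lia.
  by rewrite addnS natrD exprS -natr1; ring.
have So' : (t + 4) * (\sum_(k < N) k%:R * 'C(n.+1 + k, 2 * k + 1)%:R * t ^+ k) =
  2 * n.+1%:R * cheb R (t + 2) n.+2 - n.+2%:R * (t + 2) * cheb R (t + 2) n.+1.
  by rewrite So mulrDr IHo IHe; ring.
split=> //; rewrite Se Su mulrDr IHe mulrCA [(t + 4) * (_ + cheb _ _ _)]mulrDr So' !chebSS -!natr1.
by ring.
Qed.

(** * Hankel entries as moments, and the folded matrix *)

(* The coefficients f_k of u (1 + u) / (1 - (x - 1) u). *)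
Definition moment (R : comNzRingType) (x : R) (k : nat) : R :=
  match k with 0 => 0 | 1 => 1 | j.+2 => x * (x - 1) ^+ j end.

(* The sum in parentheses is f_|l-m|: at least one of the truncated differences
   is 0, and f_0 = 0. *)
Definition folded (R : comNzRingType) (x : R) (l m : nat) : R :=
  moment R x (l + m).+1 + (moment R x (l - m) + moment R x (m - l)).

(** The left side is the constant term of z^(k+1) f(u); for r > k + 1 the index truncates to 0,
    where [moment] is 0. *)
Lemma sum_binom_moment (R : comNzRingType) (x : R) (k : nat) :
  \sum_(r < (2 * k + 2).+1) 'C(2 * k + 2, r)%:R * moment R x (k.+1 - r) =
  \sum_(m < k.+1) 'C(2 * k + 2 - m, k - m)%:R * x ^+ m.
Proof.
case: k => [|k].
  by rewrite !big_ord_recl !big_ord0 /= !bin0 !mulr0 !addr0 mulr1.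
rewrite (_ : (2 * k.+1 + 2).+1 = k.+2 + k.+3)%N; last by lia.
rewrite big_split_ord /= [X in _ + X]big1 ?addr0; last first.
  move=> r _; rewrite (_ : k.+2 - (k.+2 + r) = 0)%N; last by lia.
  by rewrite /= mulr0.
rewrite big_ord_recr /= subSnn /= mulr1 [RHS]big_ord_recl /= !subn0 expr0 mulr1.
rewrite addrC; congr (_ + _).
transitivity (x * \sum_(r < k.+1) 'C((2 * k + 3).+1, r)%:R * (x - 1) ^+ (k - r)).
  rewrite mulr_sumr; apply: eq_bigr => r _.
  rewrite (_ : k.+2 - r = (k - r).+2)%N; last by have := ltn_ord r; lia.
  rewrite (_ : 2 * k.+1 + 2 = (2 * k + 3).+1)%N; last by lia.
  by rewrite /= mulrCA.
rewrite sum_binom_recenter; last by lia.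
rewrite mulr_sumr; apply: eq_bigr => m _.
rewrite /bump /= add1n subSS exprS mulrCA; congr ('C(_, _)%:R * _).
by lia.
Qed.

(** Folding both factors of (1 + u)^(2i+1) (1 + u)^(2j+1) yields the indices l+m+1, l-m, m-l and
    -(l+m+1); the last truncates to 0. *)
Lemma sum_binom_moment_folded (R : comNzRingType) (x : R) (i j : nat) :
  \sum_(r < (2 * (i + j) + 2).+1)
     'C(2 * (i + j) + 2, r)%:R * moment R x ((i + j).+1 - r) =
  \sum_(l < i.+1) \sum_(m < j.+1)
     'C(2 * i + 1, i - l)%:R * 'C(2 * j + 1, j - m)%:R * folded R x l m.
Proof.
rewrite (_ : 2 * (i + j) + 2 = (2 * i + 1) + (2 * j + 1))%N; last by lia.
rewrite (sum_binomD _ _ _ (fun r => moment R x ((i + j).+1 - r))).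
rewrite (sum_binom_odd _ i (fun p => \sum_(q < (2 * j + 1).+1)
  'C(2 * j + 1, q)%:R * moment R x ((i + j).+1 - (p + q)))).
apply: eq_bigr => l _; under [RHS]eq_bigr => m _ do rewrite -mulrA.
rewrite -[RHS]mulr_sumr; congr (_ * _).
rewrite (sum_binom_odd _ j (fun q => moment R x ((i + j).+1 - (i - l + q)))).
rewrite (sum_binom_odd _ j (fun q => moment R x ((i + j).+1 - (i.+1 + l + q)))).
rewrite -big_split; apply: eq_bigr => m _ /=; rewrite -mulrDr; congr (_ * _).
have lt_l := ltn_ord l; have lt_m := ltn_ord m.
rewrite (_ : (i + j).+1 - (i - l + (j - m)) = (l + m).+1)%N; last by lia.
rewrite (_ : (i + j).+1 - (i - l + (j.+1 + m)) = l - m)%N; last by lia.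
rewrite (_ : (i + j).+1 - (i.+1 + l + (j - m)) = m - l)%N; last by lia.
rewrite (_ : (i + j).+1 - (i.+1 + l + (j.+1 + m)) = 0)%N; last by lia.
by rewrite /folded /= addr0 -addrA.
Qed.

(** * Reduction to a pentadiagonal matrix *)

Definition backdiff (R : comNzRingType) (y : R) (F : nat -> R) (i : nat) : R :=
  F i - y * (if i is p.+1 then F p else 0).

Definition banded (R : comNzRingType) (x : R) (i j : nat) : R :=
  backdiff R (x - 1) (fun l => backdiff R (x - 1) (folded R x l) j) i.

Lemma det_folded (R : comNzRingType) (x : R) (n : nat) :
  \det (\matrix_(i < n, j < n) folded R x i j) =
  \det (\matrix_(i < n, j < n) banded R x i j).
Proof.
pose T (i l : nat) : R := (l == i)%:R - (x - 1) * (l.+1 == i)%:R.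
have sumT i (F : nat -> R) : \sum_(l < i.+1) T i l * F l = backdiff R (x - 1) F i.
  case: i => [|i].
    by rewrite big_ord1 /T /backdiff /=; ring.
  rewrite !big_ord_recr /= big1 ?add0r.
    rewrite /T /backdiff !eqxx (gtn_eqF (ltnSn i.+1)) (ltn_eqF (ltnSn i)) /=.
    by ring.
  move=> l _; have lt_li := ltn_ord l.
  rewrite /T eqSS (ltn_eqF lt_li) (ltn_eqF (leqW lt_li)).
  by rewrite mulr0 subr0 mul0r.
rewrite -(det_unitriangular_congruence R n T); last first.
  by move=> i; rewrite /T eqxx (gtn_eqF (ltnSn i)) mulr0 subr0.
congr (\det _); apply/matrixP => i j; rewrite !mxE /banded -sumT.
apply: eq_bigr => l _; rewrite -sumT mulr_sumr.
by apply: eq_bigr => m _; rewrite mulrA.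
Qed.

Lemma foldedC (R : comNzRingType) (x : R) (l m : nat) :
  folded R x l m = folded R x m l.
Proof. by rewrite /folded addnC [X in _ + X]addrC. Qed.

Lemma folded_addr (R : comNzRingType) (x : R) (l m d : nat) :
  m = (l + d)%N -> folded R x l m = moment R x (l + m).+1 + moment R x d.
Proof.
move=> ->; rewrite /folded addKn (_ : l - (l + d) = 0)%N; last by lia.
by rewrite add0r.
Qed.

Lemma bandedC (R : comNzRingType) (x : R) (i j : nat) :
  banded R x i j = banded R x j i.
Proof.
rewrite /banded /backdiff; case: i j => [|i] [|j] //.
- by rewrite (foldedC _ _ 0 j.+1) (foldedC _ _ 0 j); ring.
- by rewrite (foldedC _ _ 0 i.+1) (foldedC _ _ 0 i); ring.
rewrite (foldedC _ _ i.+1 j.+1) (foldedC _ _ i j.+1) (foldedC _ _ i.+1 j).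
by rewrite (foldedC _ _ i j); ring.
Qed.

(** [moment] is geometric with ratio x - 1 from index 2 on, and this far from the diagonal only such
    indices occur. *)
Lemma banded_far (R : comNzRingType) (x : R) (i j : nat) :
  (i.+2 < j)%N -> banded R x i j = 0.
Proof.
move=> lt_ij; have [d ->] : exists d, j = (i + d.+3)%N by exists (j - i.+3)%N; lia.
rewrite /banded /backdiff addnS; case: i {lt_ij} => [|i].
  by rewrite !(folded_addr R x 0 _ _ (add0n _)) !add0n /= !exprS; ring.
rewrite (folded_addr R x i.+1 _ d.+3); last by lia.
rewrite (folded_addr R x i.+1 _ d.+2); last by lia.
rewrite (folded_addr R x i _ d.+4); last by lia.
rewrite (folded_addr R x i _ d.+3); last by lia.
rewrite !(addSn, addnS) /= !exprS; ring.
Qed.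

Lemma banded2 (R : comNzRingType) (x : R) (i : nat) : banded R x i i.+2 = 1.
Proof.
rewrite /banded /backdiff; case: i => [|i].
  by rewrite !(folded_addr R x 0 _ _ (add0n _)) /= ?expr0 ?expr1; ring.
rewrite (folded_addr R x i.+1 _ 2); last by lia.
rewrite (folded_addr R x i.+1 _ 1); last by lia.
rewrite (folded_addr R x i _ 3); last by lia.
rewrite (folded_addr R x i _ 2); last by lia.
by rewrite !(addSn, addnS) /= !exprS; ring.
Qed.

Lemma banded1 (R : comNzRingType) (x : R) (i : nat) :
  banded R x i.+1 i.+2 = 2 - x.
Proof.
rewrite /banded /backdiff.
rewrite (folded_addr R x i.+1 _ 1); last by lia.
rewrite (folded_addr R x i.+1 _ 0); last by lia.
rewrite (folded_addr R x i _ 2); last by lia.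
rewrite (folded_addr R x i _ 1); last by lia.
by rewrite !(addSn, addnS) /= !exprS; ring.
Qed.

Lemma banded0 (R : comNzRingType) (x : R) (i : nat) :
  banded R x i.+2 i.+2 = 2 - 2 * x.
Proof.
rewrite /banded /backdiff (foldedC R x i.+2 i.+1).
rewrite (folded_addr R x i.+1 _ 1); last by lia.
rewrite (folded_addr R x i.+1 _ 0); last by lia.
rewrite (folded_addr R x i.+2 _ 0); last by lia.
by rewrite !(addSn, addnS) /= !exprS; ring.
Qed.

(** Rows 0 and 1 feel the corner; from row 2 on the coefficients are those of (s+2)(s-x) in u. *)
Lemma banded_kernel (R : comNzRingType) (x : R) (c : nat -> R) :
  c 0%N + 2 * c 1%N + c 2%N = 0 ->
  2 * c 0%N + 3 * (1 - x) * c 1%N + (2 - x) * c 2%N + c 3%N = 0 ->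
  (forall i, c i + (2 - x) * c i.+1 + (2 - 2 * x) * c i.+2
             + (2 - x) * c i.+3 + c i.+4 = 0) ->
  forall i, \sum_(j < i.+3) banded R x i j * c j = 0.
Proof.
move=> c0 c1 cSS [|[|i]].
- rewrite !big_ord_recr big_ord0 /= banded2 -[RHS]c0.
  by rewrite /banded /backdiff /folded /= expr0; ring.
- rewrite !big_ord_recr big_ord0 /= banded2 banded1 -[RHS]c1.
  by rewrite /banded /backdiff /folded /= !exprS; ring.
rewrite 5!big_ord_recr big1 /= => [|j _]; last first.
  by rewrite bandedC banded_far ?mul0r // !ltnS.
rewrite (bandedC _ _ i.+2 i) (bandedC _ _ i.+2 i.+1) !banded2 !banded1 banded0.
by rewrite -[RHS](cSS i); ring.
Qed.

(** * The Hankel determinant in Chebyshev form *)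

Lemma hankel_det_cheb (R : comNzRingType) (x : R) (n : nat) :
  (x + 2) * \det (\matrix_(i < n.+1, j < n.+1)
    \sum_(m < (i + j).+1) 'C(2 * (i + j) + 2 - m, i + j - m)%:R * x ^+ m) =
  (-1) ^+ n * (((2 * n%:R + 1) * x + 2) * cheb R x n.+1
               + ((2 * n%:R + 3) * x + 2) * cheb R x n).
Proof.
(* Up to normalization, a and b are the values at s = -2 and s = x of the
   orthogonal polynomials for the factor of the weight without zeros. *)
pose a k : R := (-1) ^+ k * ((2 * k%:R - 1) * x + 2).
pose b k : R := x * cheb R x k - cheb R x k.+1.
(* [b] is [cheb] delayed by one; b 0 = -1 continues the recurrence backwards. *)
have bSS k : b k.+1 = cheb R x k by rewrite /b chebSS; ring.
have Ka : forall i, \sum_(j < i.+3) banded R x i j * a j = 0.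
  apply: banded_kernel => [||i]; rewrite /a ?exprS ?expr0 -?natr1; ring.
have Kb : forall i, \sum_(j < i.+3) banded R x i j * b j = 0.
  apply: banded_kernel => [||i]; first by rewrite /b /=; ring.
    by rewrite /b /=; ring.
  by rewrite !bSS /b !chebSS; ring.
have := det_two_superdiagonals R n.+1 (banded R x) a b (banded2 R x)
  (banded_far R x) Ka Kb.
rewrite -det_folded.
rewrite -(det_unitriangular_congruence R n.+1
  (fun i l => 'C(2 * i + 1, i - l)%:R)); last by move=> i; rewrite subnn bin0.
rewrite [X in \det X](_ : _ = \matrix_(i < n.+1, j < n.+1)
    \sum_(m < (i + j).+1) 'C(2 * (i + j) + 2 - m, i + j - m)%:R * x ^+ m); last first.
  by apply/matrixP => i j; rewrite !mxE -sum_binom_moment_folded sum_binom_moment.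
set H := \det _; rewrite (bSS n.+1) (bSS n) => HE.
(* The initial Casoratian is -(x + 2). *)
transitivity (- (H * (a 0%N * b 1%N - a 1%N * b 0%N))).
  by rewrite /a /b /=; ring.
by rewrite HE /a -!natr1 !exprS; ring.
Qed.

(** * The two expansions *)

(** Used at t = x - 2, where t + 4 = x + 2. Pascal's rule on the second binomial leaves the weights
    1 and k. *)
Lemma first_sum_cheb (R : comNzRingType) (t : R) (n : nat) :
  (t + 4) * \sum_(k < n.+1)
      ((2 * n + 3) * 'C(n + k, 2 * k + 1)
       + (2 * k + 1) * 'C(n + k + 1, 2 * k + 1))%N%:R * t ^+ k =
  ((2 * n%:R + 1) * (t + 2) + 2) * cheb R (t + 2) n.+1
  + ((2 * n%:R + 3) * (t + 2) + 2) * cheb R (t + 2) n.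
Proof.
have [So Se] := sum_binom_cheb R t n.+1 n (ltnSn n).
have [Do De] := wsum_binom_cheb R t n.+1 n (ltnSn n).
transitivity ((t + 4) * ((2 * n%:R + 4) *
    (\sum_(k < n.+1) 'C(n + k, 2 * k + 1)%:R * t ^+ k)
  + (\sum_(k < n.+1) 'C(n + k, 2 * k)%:R * t ^+ k)
  + 2 * (\sum_(k < n.+1) k%:R * 'C(n + k, 2 * k + 1)%:R * t ^+ k)
  + 2 * (\sum_(k < n.+1) k%:R * 'C(n + k, 2 * k)%:R * t ^+ k))).
  congr (_ * _); rewrite !mulr_sumr -!big_split; apply: eq_bigr => k _ /=.
  by rewrite !addn1 binS !(natrD, natrM) -!natr1; ring.
rewrite So Se 2!mulrDr [_ * (2 * _)]mulrCA Do [_ * (2 * _)]mulrCA De.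
by rewrite chebSS -!natr1; ring.
Qed.

(** Used at t = -(x + 2). The factor t absorbs the binomials with 2k + 3 by an index shift; t + 4
    serves the weighted sums. *)
Lemma second_sum_cheb (R : comNzRingType) (t : R) (n : nat) :
  t * (t + 4) * \sum_(k < n.+1)
      ((n + k + 1) * 'C(n + k, 2 * k)
       + (2 * n + 4 * k + 1) * 'C(n + k, 2 * k + 1)
       + 8 * (k + 1) * 'C(n + k + 1, 2 * k + 3))%N%:R * t ^+ k =
  (t + 4) * (((2 * n%:R + 1) * (t + 2) - 2) * cheb R (t + 2) n.+1
             - ((2 * n%:R + 3) * (t + 2) - 2) * cheb R (t + 2) n).
Proof.
have [So Se] := sum_binom_cheb R t n.+1 n (ltnSn n).
have [Do De] := wsum_binom_cheb R t n.+1 n (ltnSn n).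
have shift : t * (\sum_(k < n.+1) (k + 1)%:R * 'C(n + k + 1, 2 * k + 3)%:R * t ^+ k)
    = \sum_(k < n.+1) k%:R * 'C(n + k, 2 * k + 1)%:R * t ^+ k.
  rewrite [RHS]big_ord_recl !mul0r add0r big_ord_recr /=.
  rewrite [X in _ + X](_ : _ = 0) ?addr0; last first.
    by rewrite bin_small ?mulr0 ?mul0r //; lia.
  rewrite mulr_sumr; apply: eq_bigr => k _; rewrite /bump /= add1n addn1 mulrCA -exprS.
  by congr (_ * 'C(_, _)%:R * _); lia.
transitivity ((t + 4) * (t * ((n%:R + 1) *
    (\sum_(k < n.+1) 'C(n + k, 2 * k)%:R * t ^+ k)
  + (2 * n%:R + 1) * (\sum_(k < n.+1) 'C(n + k, 2 * k + 1)%:R * t ^+ k)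
  + (\sum_(k < n.+1) k%:R * 'C(n + k, 2 * k)%:R * t ^+ k)
  + 4 * (\sum_(k < n.+1) k%:R * 'C(n + k, 2 * k + 1)%:R * t ^+ k))
  + 8 * (t * (\sum_(k < n.+1) (k + 1)%:R * 'C(n + k + 1, 2 * k + 3)%:R * t ^+ k)))).
  rewrite (mulrC t) -mulrA [8 * (t * _)]mulrCA -mulrDr; congr (_ * (_ * _)).
  rewrite !mulr_sumr -!big_split; apply: eq_bigr => k _ /=.
  by rewrite !(natrD, natrM); ring.
rewrite shift So Se.
set D := \sum_(k < _) _ in Do *; set E := \sum_(k < _) _ in De *.
transitivity (t * ((t + 4) * E) + (4 * t + 8) * ((t + 4) * D)
  + t * (t + 4) * ((n%:R + 1) * (cheb R (t + 2) n.+1 - cheb R (t + 2) n)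
                   + (2 * n%:R + 1) * cheb R (t + 2) n)); first by ring.
by rewrite Do De chebSS -!natr1; ring.
Qed.

Theorem theorem1 (n : nat) :
  hankel_det n =
    (-1) ^+ n * \sum_(0 <= k < n.+1)
      ((2 * n + 3) * 'C(n + k, 2 * k + 1)
       + (2 * k + 1) * 'C(n + k + 1, 2 * k + 1))%N%:R * ('X - 2%:R) ^+ k
  /\
  hankel_det n =
    \sum_(0 <= k < n.+1) (-1) ^+ k *
      ((n + k + 1) * 'C(n + k, 2 * k)
       + (2 * n + 4 * k + 1) * 'C(n + k, 2 * k + 1)
       + 8 * (k + 1) * 'C(n + k + 1, 2 * k + 3))%N%:R * ('X + 2%:R) ^+ k.
Proof.
(* [{poly int}] is an integral domain, so both factors can be cancelled. *)
have XD2 : 'X + 2 != 0 :> {poly int}.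
  by rewrite -size_poly_eq0 -polyC_natr size_XaddC.
have XB2 : 'X - 2 != 0 :> {poly int}.
  by rewrite -size_poly_eq0 -polyC_natr size_XsubC.
have HE : ('X + 2) * hankel_det n =
    (-1) ^+ n * (((2 * n%:R + 1) * 'X + 2) * cheb _ 'X n.+1
                 + ((2 * n%:R + 3) * 'X + 2) * cheb _ 'X n).
  rewrite -hankel_det_cheb /hankel_det.
  congr (_ * \det _); apply/matrixP => i j.
  by rewrite !mxE /hankel_entry big_mkord.
split.
  apply: (mulfI XD2); rewrite HE mulrCA big_mkord; congr (_ * _).
  have := first_sum_cheb _ ('X - 2 : {poly int}) n.
  rewrite subrK (_ : 'X - 2 + 4 = 'X + 2 :> {poly int}); last by ring.
  by move=> ->.
apply: (mulfI XD2); apply: (mulfI XB2); rewrite HE big_mkord.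
(* Here t^k supplies the sign (-1)^k, and t + 2 = -x calls for the parity of [cheb]. *)
have := second_sum_cheb _ (- ('X + 2) : {poly int}) n.
rewrite (_ : - ('X + 2) + 2 = - 'X :> {poly int}); last by ring.
rewrite !chebN.
under eq_bigr => k _ do rewrite exprNn mulrCA mulrA.
set S := \sum_(k < _) _ => S_E.
transitivity (- ('X + 2) * (- ('X + 2) + 4) * S); last by ring.
by rewrite S_E !exprS; ring.
Qed.
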